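(* Let $X$ be a Hausdorff real locally convex topological vector space, and let $f,g:X\to\mathbb{R}\cup\{+\infty\}$ be two functions with a common domain $D:=f^{-1}(\mathbb{R})=g^{-1}(\mathbb{R})$, where $D$ is nonempty and convex. Let $h:X\to\mathbb{R}$ be a continuous convex function such that $h(\theta)=0$. Then the following statements are equivalent: (i) $f$ and $g$ are convex, lower semicontinuous on $D$, and satisfy $$f(x)-g(x)\leq f(y)-g(y)+h(x-y)\quad\text{for all }x,y\in D.$$ (ii) For each $x\in D$, $$\emptyset\neq\partial_{\varepsilon}f(x)\subset\partial_{\varepsilon}g(x)+\partial_{\varepsilon}h(\theta)\quad\text{for all }\varepsilon>0.$$ (iii) For each $x\in D$ there exists $\delta>0$ such that $$\emptyset\neq\partial_{\varepsilon}f(x)\subset\partial_{\varepsilon}g(x)+\partial_{\varepsilon}h(\theta)\quad\text{for all }\varepsilon\in(0,\delta).$$ (iv) For each $x\in D$, $$\partial_{\varepsilon}f(x)\cap\left(\partial_{\varepsilon}g(x)+\partial_{\varepsilon}h(\theta)\right)\neq\emptyset\quad\text{for all }\varepsilon>0.$$ (v) For each $x\in D$ there exists $\delta>0$ such that $$\partial_{\varepsilon}f(x)\cap\left(\partial_{\varepsilon}g(x)+\partial_{\varepsilon}h(\theta)\right)\neq\emptyset\quad\text{for all }\varepsilon\in(0,\delta).$$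
   Context: $X^{*}$ is the topological dual of $X$, $\langle\cdot,\cdot\rangle:X\times X^{*}\to\mathbb{R}$ is the duality product, and $\theta$ denotes the zero vector (of $X$ or of $X^{*}$). For a function $\varphi:X\to\mathbb{R}\cup\{+\infty\}$, a point $x\in X$ with $\varphi(x)<+\infty$, and $\varepsilon>0$, the $\varepsilon$-subdifferential is $$\partial_{\varepsilon}\varphi(x):=\{x^{*}\in X^{*}:\ \varphi(y)-\varphi(x)\geq\langle y-x,x^{*}\rangle-\varepsilon\ \text{ for all }y\in X\}.$$ Sums of subsets of $X^{*}$ are Minkowski sums. ''Lower semicontinuous on $D$'' means lower semicontinuous at every point of $D$. *)

(* Defs.v *)
From mathcomp Require Import all_boot all_order all_algebra.
From mathcomp Require Import all_classical all_reals all_analysis.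

Set Implicit Arguments.
Unset Strict Implicit.
Unset Printing Implicit Defensive.

Import Order.TTheory GRing.Theory Num.Theory.
Import numFieldNormedType.Exports.

Local Open Scope classical_set_scope.
Local Open Scope ring_scope.
Local Open Scope convex_scope.

(* The topological dual is a set of functions, so that the duality product
   <x, l> is the application [l x] and the sum in the dual is pointwise. *)
Definition topological_dual (R : realType) (X : tvsType R) : set (X -> R^o) :=
  [set l | linear l /\ continuous l].

Definition minkowski_sum (R : realType) (X : tvsType R) (A B : set (X -> R^o)) :
  set (X -> R^o) := [set u \+ v | u in A & v in B].

(* Meant for phi x finite. For phi x = +oo the set is empty, because
   +oo - +oo = -oo in \bar R. *)
Definition eps_subdiff (R : realType) (X : tvsType R) (eps : R)
    (phi : X -> \bar R) (x : X) : set (X -> R^o) :=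
  [set l | topological_dual l /\
    forall y, ((l (y - x) - eps)%:E <= phi y - phi x)%E].

(* For f with values in R U {+oo}: the right-hand side then never adds
   opposite infinities, and 0 * +oo = 0 in \bar R makes the extreme values
   t = 0, 1 harmless. *)
Definition econvex_function (R : realType) (X : tvsType R) (f : X -> \bar R) :=
  forall (t : {i01 R}) (x y : convex_lmodType X),
    (f (x <| t |> y) <= t%:num%:E * f x + (1 - t%:num)%:E * f y)%E.

(* Neighbourhoods are taken in X, not in the subspace D. *)
Definition lower_semicontinuous_on (R : realType) (X : topologicalType)
    (D : set X) (f : X -> \bar R) :=
  forall x, D x -> forall a : R, (a%:E < f x)%E ->
    exists2 V, nbhs x V & forall y, V y -> (a%:E < f y)%E.

(* Main.v *)
Require Import Defs.
From HB Require Import structures.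
From mathcomp Require Import all_boot all_order all_algebra.
From mathcomp Require Import all_classical all_reals all_analysis.
From mathcomp Require Import ring lra.

(** Condition (i) bounds the increments of f by those of g and by h, and the
    other conditions are its infinitesimal form: one passes from (i) to them by
    separation of convex sets, and back by integration along segments.

    Condition (i) says that, for all x and y in D,
<<
      f y - f x <= g y - g x + h (y - x).
>>
    Hence an eps-subgradient of f at x is one of the function
    y |-> g y + h (y - x), and the sum rule for eps-subdifferentials splits it
    into an eps-subgradient of g at x and one of h at 0.  The rule is an
    instance of the sandwich theorem [sandwich]: two convex functions, one of
    which is continuous, are separated by a continuous affine function.  The
    same theorem, applied to the zero function on a convex neighbourhood where
    f stays above f x - eps, shows that eps-subgradients of a convex function
    exist at every point of D where it is lower semicontinuous.  Both rest on
    the Hahn-Banach theorem in the form [hahn_banach_convex].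

    Conversely, let f have an eps-subgradient u + v at each point of D and for
    each eps, with u an eps-subgradient of g at that point and v one of h at 0.
    Existence of eps-subgradients makes f and g convex and lower
    semicontinuous.  For the inequality ([increment_comparison]), the segment
    from x to y is cut into n equal steps d.  On each step the increments of f
    and g are compared through u and v.  The terms in u telescope to
    u_n d - u_0 d, which is O(1/n) provided that the subgradients u_0 and u_n at
    the two end points are chosen before n; the terms in v add up to at most
    n * h (- d) <= h (x - y).  The precision e is kept fixed at the two end
    points and is e / n at the n - 1 points in between, so that the total error
    is O(e).

    Between (ii) and (v), only monotonicity in eps of the eps-subdifferential
    is at work: a point of the intersection for a small eps is also one for
    every larger eps. *)

Import Order.TTheory GRing.Theory Num.Theory.
Import numFieldNormedType.Exports.

Local Open Scope classical_set_scope.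
Local Open Scope ring_scope.

Set Implicit Arguments.
Unset Strict Implicit.
Unset Printing Implicit Defensive.

(** * Convexity with an unbundled parameter *)

Lemma convex_setP (R : realType) (E : lmodType R) (A : set E) :
  convex_set A <-> forall (t : R) (x y : E), 0 <= t -> t <= 1 ->
    A x -> A y -> A (t *: x + (1 - t) *: y).
Proof.
split=> [cA t x y t0 t1 Ax Ay|cA x y t].
  by have := cA x y (Itv01 t0 t1); rewrite !inE; exact.
by rewrite !inE => Ax Ay; exact: cA.
Qed.

Lemma convex_functionP (R : realType) (E : lmodType R) (A : set E)
    (f : E -> R^o) :
  convex_function A f <-> forall (t : R) (x y : E), 0 <= t -> t <= 1 ->
    A x -> A y -> f (t *: x + (1 - t) *: y) <= t * f x + (1 - t) * f y.
Proof.
split=> [cf t x y t0 t1 Ax Ay|cf t x y].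
  by have := cf (Itv01 t0 t1) x y; rewrite !inE; exact.
by rewrite !inE => Ax Ay; exact: cf.
Qed.

(** * Hahn-Banach for convex sets of X * R *)

Section HahnBanach.
Variables (R : realType) (X : lmodType R).
Implicit Types C : set (X * R^o).

(** Read C as a set of upper bounds: (u, r) in C asks that l u <= r for the
    linear function l to be found.  At u = 0 this can be satisfied only if
    r is nonnegative. *)
Definition nonneg_on_axis C := forall r : R, C (0, r) -> 0 <= r.

(** The bounds imposed on the value c of l at y: a point of C above - t y asks
    for c >= - r / t, a point above s y for c <= r' / s.  They are compatible
    because the segment between two such points meets the axis u = 0 at height
    (s r + t r') / (s + t). *)
Lemma nonneg_on_axis_supporting_slope C (y : X) :
  convex_set C -> nonneg_on_axis C ->
  (forall u, exists2 lambda : R, 0 < lambda & exists r, C (lambda *: u, r)) ->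
  exists c : R, forall t r, C (- (t *: y), r) -> 0 <= r + t * c.
Proof.
move=> /convex_setP cC C0 absC.
have slopes (s t r r' : R) : 0 < s -> 0 < t -> C (- (t *: y), r) ->
    C (s *: y, r') -> - r / t <= r' / s.
  move=> s0 t0 Cr Cr'; have st0 : 0 < s + t by exact: addr_gt0.
  have := cC (s / (s + t)) _ _ _ _ Cr Cr'.
  have -> : (s / (s + t) *: (- (t *: y), r : R^o)
             + (1 - s / (s + t)) *: (s *: y, r' : R^o))
            = (0, (s * r + t * r') / (s + t)) :> X * R^o.
    have e : 1 - s / (s + t) = t / (s + t) by field; lra.
    rewrite e; congr (_, _).
      rewrite /= scalerN !scalerA addrC -scalerBl.
      have -> : t / (s + t) * s - s / (s + t) * t = 0 by ring.
      by rewrite scale0r.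
    by rewrite /= /GRing.scale /=; field; lra.
  have -> : 0 <= s / (s + t) by rewrite divr_ge0 ?ltW.
  have -> : s / (s + t) <= 1 by rewrite ler_pdivrMr// mul1r lerDl ltW.
  move=> /(_ isT isT) /C0; rewrite pmulr_lge0 ?invr_gt0// => h.
  by rewrite ler_pdivrMr// mulrAC ler_pdivlMr//; nra.
pose L : set R :=
  [set a | exists2 t, 0 < t & exists2 r, C (- (t *: y), r) & a = - r / t].
have [s s0 [r' Cr']] := absC y.
have [t0 t00 [r0 Cr0]] := absC (- y); rewrite scalerN in Cr0.
have L0 : L !=set0 by exists (- r0 / t0), t0 => //; exists r0.
have ubL s1 r1 : 0 < s1 -> C (s1 *: y, r1) -> ubound L (r1 / s1).
  by move=> ? ? _ [t ? [r ? ->]]; exact: slopes.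
exists (sup L) => t r Ctr; have [t1|t1|t1] := ltgtP t 0.
- have := sup_le_ub L0 (ubL (- t) r _ _).
  rewrite oppr_gt0 scaleNr => /(_ t1 Ctr).
  by rewrite ler_pdivlMr ?oppr_gt0//; lra.
- have : - r / t <= sup L.
    by apply: ub_le_sup; [exists (r' / s); exact: ubL|exists t => //; exists r].
  by rewrite ler_pdivrMr//; lra.
- by move: Ctr; rewrite t1 scale0r oppr0 mul0r addr0; exact: C0.
Qed.

Lemma convex_add_line C (y : X) (c : R) : convex_set C ->
  convex_set [set p : X * R^o | exists t : R, C (p - t *: (y, c : R^o))].
Proof.
move=> /convex_setP cC; apply/convex_setP => t p q t0 t1 [a Ca] [b Cb].
exists (t * a + (1 - t) * b).
have -> : t *: p + (1 - t) *: q - (t * a + (1 - t) * b) *: (y, c : R^o)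
  = t *: (p - a *: (y, c : R^o)) + (1 - t) *: (q - b *: (y, c : R^o)).
  by rewrite !scalerBr !scalerA addrACA -opprD -scalerDl.
exact: cC.
Qed.

(** Zorn's lemma is applied to the sets A whose union with C is convex and
    nonnegative on the axis, rather than to the supersets of C with these
    properties, so that the empty chain needs no separate treatment. *)
Lemma maximal_nonneg_on_axis C : convex_set C -> nonneg_on_axis C ->
  exists M, [/\ C `<=` M, convex_set M, nonneg_on_axis M &
    forall M', M `<=` M' -> convex_set M' -> nonneg_on_axis M' -> M' `<=` M].
Proof.
move=> cC C0.
pose P A := convex_set (C `|` A) /\ nonneg_on_axis (C `|` A).
have [F FP Ftot|A [[cA A0] Amax]] := @Zorn_bigcup _ P.
  have chain p q : (C `|` \bigcup_(A in F) A) p ->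
      (C `|` \bigcup_(A in F) A) q ->
      (C p /\ C q) \/ exists2 A, F A & (C `|` A) p /\ (C `|` A) q.
    move=> [Cp|[A FA Ap]] [Cq|[B FB Bq]]; first by left.
    - by right; exists B => //; split; [left|right].
    - by right; exists A => //; split; [right|left].
    - have [AB|BA] := Ftot _ _ FA FB; right.
        by exists B => //; split; right => //; exact: AB.
      by exists A => //; split; right => //; exact: BA.
  split.
    apply/convex_setP => t p q t0 t1 Cp Cq.
    have [[{}Cp {}Cq]|[A FA [Ap Aq]]] := chain _ _ Cp Cq.
      by left; apply: (convex_setP C).1.
    have /convex_setP/(_ t p q t0 t1 Ap Aq)[] := (FP _ FA).1; first by left.
    by right; exists A.
  move=> r [/C0//|[A FA Ar]].
  by have [_ FA0] := FP _ FA; apply: FA0; right.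
exists (C `|` A); split => //.
move=> M AM cM M0.
have CM : C `|` M = M by apply/setUidPr => p Cp; apply: AM; left.
have PM : P M by rewrite /P CM.
apply/not_notP => nM; apply: (Amax M) => //; split.
  by move=> p Ap; apply: AM; right.
by move=> MA; apply: nM => p Mp; right; exact: MA.
Qed.

(** For C the epigraph of a sublinear function this is the usual Hahn-Banach
    theorem.  Enlarge C to a maximal convex set M that is nonnegative on the
    axis.  By [nonneg_on_axis_supporting_slope], for each y some line spanned
    by a vector (y, l y) can be added to M without losing these properties; by
    maximality M is already invariant under translation along that line.  The
    invariance gives everything: if l were not linear, M would contain the whole
    vertical line u = 0, and if (u, r) is in M then so is (0, r - l u), whence
    l u <= r. *)
Theorem hahn_banach_convex C : convex_set C -> nonneg_on_axis C ->
  (forall u, exists2 lambda : R, 0 < lambda & exists r, C (lambda *: u, r)) ->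
  exists2 l : X -> R^o, linear l & forall u r, C (u, r) -> l u <= r.
Proof.
move=> cC C0 absC; have [M [CM cM M0 Mmax]] := maximal_nonneg_on_axis cC C0.
have absM u : exists2 lambda : R, 0 < lambda & exists r, M (lambda *: u, r).
  by have [s s0 [r /CM Mr]] := absC u; exists s => //; exists r.
have dir y : exists c : R, forall p t, M p -> M (p + t *: (y, c : R^o)).
  have [c Hc] := nonneg_on_axis_supporting_slope y cM M0 absM.
  exists c => p t Mp.
  have sub := Mmax _ _ (@convex_add_line M y c cM).
  apply: sub => [q Mq|r [s Ms]|].
  - by exists 0; rewrite scale0r subr0.
  - have := Hc s (r - s * c); rewrite subrK; apply.
    by move: Ms; congr M; congr (_, _); rewrite /= sub0r.
  - by exists t; rewrite addrK.
have [l Hl] := choice dir.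
have [s _ [r0]] := absM 0; rewrite scaler0 => Mr0.
(* A nonzero c would put the negative number -1 on the axis of M. *)
have vert (c : R) : (forall t, M (0, r0 + t * c)) -> c = 0.
  move=> Mc; apply/eqP/negP => /negP c0.
  have := M0 _ (Mc (- (r0 + 1) / c)); rewrite divfK//; lra.
exists l => [a u v|u r /CM Mur].
  apply/eqP; rewrite -subr_eq0; apply/eqP/vert => t.
  have := Hl u _ (- (t * a)) (Hl v _ (- t) (Hl (a *: u + v) _ t Mr0)).
  congr M; congr (_, _); rewrite /=.
    rewrite add0r scalerDr scalerA !scaleNr -addrA -opprD addrC.
    by rewrite [t *: v + _]addrC addNr.
  by rewrite /GRing.scale /=; ring.
have := Hl u _ (-1) Mur.
have -> : (u, r : R^o) + -1 *: (u, l u) = (0, r - l u) :> X * R^o.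
  by rewrite scaleN1r; congr (_, _); rewrite /= subrr.
by move=> /M0; rewrite subr_ge0.
Qed.

End HahnBanach.

(** * Separation by continuous linear functions *)

(** Gives access to the lemmas on bundled linear functions when linearity is
    only a proposition, as it is for members of the topological dual. *)
Lemma linear_packed (R : realType) (X : lmodType R) (l : X -> R^o) :
  linear l -> exists L : {linear X -> R^o}, l = L.
Proof.
move=> lin_l.
pose L : {linear X -> R^o} := HB.pack l (GRing.isLinear.Build _ _ _ _ _ lin_l).
by exists L.
Qed.

Section LocallyConvex.
Variables (R : realType) (X : tvsType R).

Lemma nbhs0_absorbing (V : set X) (u : X) : nbhs 0 V ->
  exists2 lambda : R, 0 < lambda & V (lambda *: u).
Proof.
move=> V0; have := @scale_continuous _ X (0, u) V.
rewrite /= scale0r => /(_ V0) [[B1 B2] [/= /nbhs_ballP[e /= e0 eB] nB2] BV].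
exists (e / 2); first by rewrite divr_gt0.
apply: (BV (e / 2, u)); split => /=; last exact: nbhs_singleton.
apply: eB; rewrite /ball /= sub0r normrN gtr0_norm ?divr_gt0//.
by rewrite ltr_pdivrMr// ltr_pMr// ltr1n.
Qed.

Lemma nbhs0_convex_basis (x : X) (U : set X) : nbhs x U ->
  exists V : set X, [/\ convex_set V, nbhs 0 V & forall v, V v -> U (x + v)].
Proof.
have [B Bconvex [Bopen Bbasis]] := @locally_convex R X.
move=> /Bbasis[b [Bb bx] bU].
exists [set v | b (x + v)]; split => [||v]; last exact: bU.
- apply/convex_setP => t v w t0 t1 /= bv bw.
  have /convex_setP/(_ t _ _ t0 t1 bv bw) := Bconvex b (mem_set Bb).
  by rewrite !scalerDr addrACA -scalerDl subrKC scale1r.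
- have nb : nbhs x b by apply: open_nbhs_nbhs; split => //; exact: Bopen.
  have := nbhsB (- x) nb; rewrite addNr; apply: filterS => _ [y yb <-] /=.
  by rewrite addNKr.
Qed.

(** On the symmetric neighbourhood where u and - u are both in U, |l| <= M;
    shrinking it by the factor e / (M + 1) makes |l| < e. *)
Lemma linear_bounded_above_continuous (l : X -> R^o) (U : set X) (M : R) :
  linear l -> nbhs 0 U -> (forall u, U u -> l u <= M) -> continuous l.
Proof.
move=> lin_l U0 lM x.
have [L lE] := linear_packed lin_l.
have M0 : 0 <= M by rewrite -(linear0 L) -lE lM//; exact: nbhs_singleton.
have M1 : 0 < M + 1 by lra.
apply/cvgrPdist_lt => e e0.
have r0 : 0 < e / (M + 1) by exact: divr_gt0.
have W0 : nbhs 0 (U `&` -%R @` U) by apply: filterI => //; exact: nbhs0N.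
have nx := nbhsT x (nbhs0Z (lt0r_neq0 r0) W0).
apply: filterS nx => _ [_ [w [Uw [w' Uw' w'E]] <-] <-].
have lw : `|l w| <= M.
  rewrite ler_norml lM// andbT lerNl.
  have -> : - l w = l w' by rewrite -w'E lE linearN opprK.
  exact: lM.
rewrite lE linearD linearZ -lE opprD addrA subrr sub0r normrN normrM.
rewrite gtr0_norm//.
rewrite mulrAC ltr_pdivrMr// ltr_pM2l//.
by apply: le_lt_trans lw _; rewrite ltrDl.
Qed.

(** Both conclusions are cases of the bounds
<<
      l (d - x - v) <= f d - f x + H v + eps      (d in D, v in V),
>>
    for v = 0 and for d = x.  These upper bounds on l form the convex set C of
    the proof, and d - x - v = 0 exactly when v = d - x, so that the hypothesis
    makes C nonnegative above 0.  Continuity of l comes from - l <= H + eps,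
    since H is bounded above near 0. *)
Lemma sandwich (V D : set X) (H f : X -> R^o) (x : X) (eps : R) :
  convex_set V -> convex_function V H -> nbhs 0 V -> {for 0, continuous H} ->
  H 0 = 0 -> convex_set D -> convex_function D f -> D x ->
  (forall d, D d -> V (d - x) -> 0 <= f d - f x + H (d - x) + eps) ->
  exists l, [/\ topological_dual l,
    forall d, D d -> l (d - x) - eps <= f d - f x &
    forall v, V v -> - l v <= H v + eps].
Proof.
move=> /convex_setP cV /convex_functionP cH V0 H_cont H0.
move=> /convex_setP cD /convex_functionP cf Dx ge0.
have VV0 : V 0 by exact: nbhs_singleton.
pose C : set (X * R^o) := [set p | exists d v, [/\ D d, V v,
  p.1 = d - x - v & f d - f x + H v + eps <= p.2]].
have [|r [d [v [Dd Vv /= dv]]]||l lin_l lC] := @hahn_banach_convex _ _ C.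
- apply/convex_setP => t [p1 p2] [q1 q2] t0 t1 /= [d [v [Dd Vv /= -> pr]]].
  move=> [d' [v' [Dd' Vv' /= -> qr]]].
  exists (t *: d + (1 - t) *: d'), (t *: v + (1 - t) *: v'); split => /=.
  + exact: cD.
  + exact: cV.
  + rewrite !scalerBr addrACA -opprD; congr (_ - _).
    by rewrite addrACA -opprD -scalerDl subrKC scale1r.
  + have := cf _ _ _ t0 t1 Dd Dd'; have := cH _ _ _ t0 t1 Vv Vv'.
    rewrite /GRing.scale /=; nra.
- move/eqP: dv; rewrite eq_sym subr_eq0 => /eqP dv.
  by apply: le_trans; rewrite -dv; apply: ge0 => //; rewrite dv.
- move=> u; have [s s0 Vs] := nbhs0_absorbing (- u) V0.
  exists s => //; exists (H (s *: - u) + eps), x, (s *: - u); split => //=.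
    by rewrite subrr sub0r scalerN opprK.
  by rewrite subrr add0r.
have [L lE] := linear_packed lin_l.
have lV v : V v -> - l v <= H v + eps.
  move=> Vv; rewrite [- l v](_ : _ = l (- v)); last by rewrite lE linearN.
  apply: lC; exists x, v; split => //=; first by rewrite subrr sub0r.
  by rewrite subrr add0r.
exists l; split => // [|d Dd]; last first.
  rewrite lerBlDr; apply: lC; exists d, 0; split => //=; first by rewrite subr0.
  by rewrite H0 addr0.
split => //.
have nH : nbhs 0 [set v | H v < 1].
  by apply: (H_cont [set r | r < 1]); rewrite H0; exact: lt_nbhsl.
have VH0 : nbhs 0 (-%R @` (V `&` [set v | H v < 1])).
  by apply: nbhs0N; exact: filterI.
apply: (linear_bounded_above_continuous (M := 1 + eps) lin_l VH0).
move=> _ [v [Vv Hv] <-]; rewrite lE linearN -lE.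
by have := lV v Vv; move: Hv => /=; lra.
Qed.

End LocallyConvex.

(** * Existence of eps-subgradients *)

Lemma topological_dualB (R : realType) (X : tvsType R) (k l : X -> R^o) :
  topological_dual k -> topological_dual l -> topological_dual (k \- l).
Proof.
move=> [/linear_packed[K ->] K_cont] [/linear_packed[L ->] L_cont]; split.
  by move=> a u v; rewrite /= !linearP /GRing.scale /=; ring.
by move=> x; apply: cvgB; [exact: K_cont|exact: L_cont].
Qed.

Lemma eps_subdiff_le (R : realType) (X : tvsType R) (f : X -> \bar R) (x : X)
    (e e' : R) : e <= e' -> eps_subdiff e f x `<=` eps_subdiff e' f x.
Proof.
move=> ee' l [l_dual lf]; split => // y; apply: le_trans (lf y).
by rewrite lee_fin lerB.
Qed.

Section FiniteOnDomain.
Variables (R : realType) (X : tvsType R) (f : X -> \bar R) (D : set X).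
Hypotheses (f_gtNy : forall x, f x <> -oo%E)
  (domf : D = [set x | f x \is a fin_num]).
Implicit Types (x y : X) (eps : R).

Lemma dom_fineK x : D x -> f x = (fine (f x))%:E.
Proof. by rewrite domf /= => /fineK. Qed.

Lemma notin_dom x : ~ D x -> f x = +oo%E.
Proof. by rewrite domf /=; have := @f_gtNy x; case: (f x). Qed.

Lemma eps_subdiffP eps x (l : X -> R^o) : D x ->
  eps_subdiff eps f x l <-> topological_dual l /\
    forall y, D y -> l (y - x) - eps <= fine (f y) - fine (f x).
Proof.
move=> Dx; split=> -[l_dual lf]; split=> // y.
  by move=> Dy; have := lf y; rewrite (dom_fineK Dx) (dom_fineK Dy).
rewrite (dom_fineK Dx).
have [Dy|/notin_dom ->] := pselect (D y); last by rewrite addye// leey.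
by rewrite (dom_fineK Dy) -EFinB lee_fin; exact: lf.
Qed.

Lemma econvex_functionP : convex_set D ->
  econvex_function f <-> convex_function D (fine \o f : X -> R^o).
Proof.
move=> /convex_setP cD; split => [cf|/convex_functionP cf].
  apply/convex_functionP => t x y t0 t1 Dx Dy /=.
  have := cf (Itv01 t0 t1) x y.
  have := dom_fineK (cD _ _ _ t0 t1 Dx Dy); rewrite /conv /= => ->.
  by rewrite (dom_fineK Dx) (dom_fineK Dy).
move=> t x y.
have t0 : 0 <= t%:num by [].
have t1 : t%:num <= 1 by [].
have [->|tn0] := eqVneq t 0%:i01.
  by rewrite conv0 /= mul0e add0e subr0 mul1e.
have [->|tn1] := eqVneq t 1%:i01.
  by rewrite conv1 /= subrr mul1e mul0e adde0.
have {}tn0 : 0 < t%:num by rewrite lt_neqAle eq_sym tn0.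
have {}tn1 : 0 < 1 - t%:num by rewrite subr_gt0 lt_neqAle tn1.
have [Dx|/notin_dom ->] := pselect (D x); last first.
  rewrite gt0_muley ?lte_fin// addye ?leey//.
  have [Dy|/notin_dom ->] := pselect (D y); last by rewrite gt0_muley ?lte_fin.
  by rewrite (dom_fineK Dy).
have [Dy|/notin_dom ->] := pselect (D y); last first.
  by rewrite gt0_muley ?lte_fin// (dom_fineK Dx) leey.
rewrite (dom_fineK Dx) (dom_fineK Dy) (dom_fineK (cD _ _ _ t0 t1 Dx Dy)).
by have := cf _ _ _ t0 t1 Dx Dy; rewrite -lee_fin.
Qed.

(** Lower semicontinuity gives a convex neighbourhood of x on which
    f > f x - eps: there the zero function can be sandwiched with f. *)
Lemma eps_subdiff_neq0 x eps : convex_set D -> econvex_function f ->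
  lower_semicontinuous_on D f -> D x -> 0 < eps -> eps_subdiff eps f x !=set0.
Proof.
move=> cD /(econvex_functionP cD) cf lscf Dx eps0.
have [U xU Uf] : exists2 U, nbhs x U &
    forall y, U y -> ((fine (f x) - eps)%:E < f y)%E.
  by apply: lscf; rewrite // [ltRHS]dom_fineK// lte_fin ltrBlDr ltrDl.
have [V [cV V0 VU]] := nbhs0_convex_basis xU.
have [||d Dd Vd|l [l_dual lf _]] :=
    @sandwich R X V D (fun=> 0) (fine \o f) x eps cV _ V0 _ erefl cD cf Dx.
- by apply/convex_functionP => t a b *; rewrite !mulr0 addr0.
- exact: cvg_cst.
- have := Uf _ (VU _ Vd); rewrite subrKC (dom_fineK Dd) lte_fin /=; lra.
by exists l; apply/eps_subdiffP.
Qed.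

(** Compare f at x and y with an e-subgradient taken at the intermediate
    point, and let e tend to 0. *)
Lemma eps_subdiff_neq0_convex : convex_set D ->
  (forall x, D x -> forall eps, 0 < eps -> eps_subdiff eps f x !=set0) ->
  econvex_function f.
Proof.
move=> cD f_sub; apply/econvex_functionP => //.
move/convex_setP: cD => cD; apply/convex_functionP => t x y t0 t1 Dx Dy /=.
have Dz := cD _ _ _ t0 t1 Dx Dy; set z := _ + _ in Dz *.
apply/ler_addgt0Pr => e e0; have [l /(eps_subdiffP _ _ Dz)] := f_sub z Dz e e0.
move=> [[/linear_packed[L ->] _] Lf].
have := Lf x Dx; have := Lf y Dy.
have : t * L (x - z) + (1 - t) * L (y - z) = 0.
  rewrite -[LHS](_ : L (t *: (x - z) + (1 - t) *: (y - z)) = _); last first.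
    by rewrite linearD !linearZ.
  by rewrite !scalerBr addrACA -opprD -scalerDl subrKC scale1r subrr linear0.
by nra.
Qed.

(** An e-subgradient l at x keeps f y above f x - 2 e as long as
    l (y - x) > - e; hence the choice of e as half the gap between f x and a. *)
Lemma eps_subdiff_neq0_lsc :
  (forall x, D x -> forall eps, 0 < eps -> eps_subdiff eps f x !=set0) ->
  lower_semicontinuous_on D f.
Proof.
move=> f_sub x Dx a; rewrite (dom_fineK Dx) lte_fin => afx.
have e0 : 0 < (fine (f x) - a) / 2 by rewrite divr_gt0 ?subr_gt0.
have [l [[/linear_packed[L ->] L_cont] Lf]] := f_sub x Dx _ e0.
set e := _ / 2 in e0 Lf.
exists [set y | L x - e < L y].
  apply: (L_cont x [set r | L x - e < r]); apply: lt_nbhsr.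
  by rewrite ltrBlDr ltrDl.
move=> y /= xy; have := Lf y.
have [Dy|/notin_dom -> _] := pselect (D y); last exact: ltry.
rewrite (dom_fineK Dx) (dom_fineK Dy) -EFinB lee_fin lte_fin.
by rewrite linearB /=; rewrite /e in xy *; lra.
Qed.

End FiniteOnDomain.

(** * Integration of eps-subgradients along a segment *)

Section Increments.
Variables (R : realType) (X : lmodType R) (D : set X) (F G h : X -> R^o).
Hypotheses (D_convex : convex_set D) (h_convex : convex_function setT h)
  (h0 : h 0 = 0).

Definition common_eps_slopes (x : X) (eps : R) (u v : {linear X -> R^o}) :=
  [/\ D x, forall y, D y -> u (y - x) + v (y - x) - eps <= F y - F x,
   forall y, D y -> u (y - x) - eps <= G y - G x &
   forall z, v z - eps <= h z].

(** The increment of f is estimated at the start of the step and that of g at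
    its end, each from the side on which the subgradient inequality bounds it;
    this is what makes the terms in u telescope. *)
Lemma common_eps_slopes_step (x d : X) (e e' : R)
    (u v u' v' : {linear X -> R^o}) :
  common_eps_slopes x e u v -> common_eps_slopes (x + d) e' u' v' ->
  (F x - G x) - (F (x + d) - G (x + d))
  <= u' d - u d + h (- d) + 2 * e + e'.
Proof.
move=> [Dx uvF uG vh] [Dxd uvF' uG' vh'].
have := uvF _ Dxd; have := uG' _ Dx; have := vh (- d).
rewrite [x + d - x]addrAC subrr add0r opprD addNKr !linearN /=; lra.
Qed.

(** The error 7 e consists of e for u_n d - u_0 d, of 3 e for the two end
    points, where the precision is e, and of 3 (n - 1) eta <= 3 e for the
    intermediate points, where it is eta = e / n. *)
Lemma increment_comparison :
  (forall x, D x -> forall eps, 0 < eps ->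
    exists u v, common_eps_slopes x eps u v) ->
  forall x y, D x -> D y -> F x - G x <= F y - G y + h (x - y).
Proof.
move=> slopes x y Dx Dy; apply/ler_addgt0Pr => e7 e70.
have [e [e0 ->]] : exists e, 0 < e /\ e7 = 7 * e.
  by exists (e7 / 7); rewrite divr_gt0//; split=> //; field.
have [u0 [v0 uv0]] := slopes x Dx e e0.
have [un [vn uvn]] := slopes y Dy e e0.
(* The slopes at the end points are fixed before n, hence so is c. *)
pose c := un (y - x) - u0 (y - x).
(* At least two steps, so that the first and the last one are distinct. *)
pose m := Num.bound (`|c| / e); pose n : R := m.+2%:R.
have n0 : 0 < n by rewrite ltr0n.
pose eta := e / n; have eta0 : 0 < eta by exact: divr_gt0.
pose d := n^-1 *: (y - x).
have cn : un d - u0 d <= e.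
  rewrite /d !linearZ -scalerDr -/c /GRing.scale /= mulrC ler_pdivrMr//.
  have : `|c| / e < m%:R by apply: archi_boundP; rewrite divr_ge0// ltW.
  rewrite ltr_pdivrMr// => cm; apply: le_trans (ler_norm _) _.
  by apply: le_trans (ltW cm) _; rewrite mulrC ler_pM2l// ler_nat leqW.
have hd : n * h (- d) <= h (x - y).
  have n1 : n^-1 <= 1 by rewrite invf_le1// ler1n.
  have nV0 : 0 <= n^-1 by rewrite invr_ge0 ltW.
  have := (convex_functionP _ _).1 h_convex _ (x - y) 0 nV0 n1 I I.
  rewrite h0 mulr0 addr0 scaler0 addr0 -[x - y]opprB scalerN -/d.
  by rewrite [_ * h _]mulrC ler_pdivlMr// mulrC.
pose p k := x + k%:R *: d.
have pS k : p k.+1 = p k + d by rewrite /p -addrA -natr1 scalerDl scale1r.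
have pn : p m.+2 = y.
  by rewrite /p /d scalerA divff ?lt0r_neq0// scale1r subrKC.
have Dp k : (k <= m.+2)%N -> D (p k).
  move=> km; rewrite [p k](_ : _ = (k%:R / n) *: y + (1 - k%:R / n) *: x).
    apply: (convex_setP _).1 => //; first by rewrite divr_ge0 ?ler0n ?ltW.
    by rewrite ler_pdivrMr// mul1r ler_nat.
  by rewrite /p /d scalerA scalerBr scalerBl scale1r addrCA.
(* The first k + 1 steps; the precision is e at p 0 and eta afterwards. *)
have chain k : (k <= m)%N -> exists u v, common_eps_slopes (p k.+1) eta u v /\
    (F x - G x) - (F (p k.+1) - G (p k.+1))
    <= u d - u0 d + k.+1%:R * h (- d) + 2 * e + 3 * k.+1%:R * eta.
  elim: k => [|k IHk] km.
    have [u [v uv]] := slopes _ (Dp 1%N isT) _ eta0; exists u, v; split=> //.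
    have p0 : x = p 0%N by rewrite /p scale0r addr0.
    move: uv0 uv; rewrite p0 pS => uv0 uv.
    by have := common_eps_slopes_step uv0 uv; lra.
  have [u [v [uv le_k]]] := IHk (ltnW km).
  have [|u' [v' uv']] := slopes (p k.+2) _ _ eta0.
    by apply: Dp; rewrite !ltnS ltnW.
  exists u', v'; split=> //; move: uv'; rewrite pS => uv'.
  have := common_eps_slopes_step uv uv'.
  by rewrite -[k.+2%:R]natr1; lra.
have [u [v [uv le_m]]] := chain m (leqnn m).
move: uvn; rewrite -pn pS => uvn.
have := common_eps_slopes_step uv uvn; rewrite -pS pn => le_n.
have neta : n * eta = e by rewrite /eta mulrC divfK ?lt0r_neq0.
have nE : n = m.+1%:R + 1 by rewrite /n natr1.
rewrite nE in hd neta; nra.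
Qed.

End Increments.

(** * The sum rule and the equivalences *)

(** Under the bound on increments, l is an eps-subgradient at x of
    g + h (. - x).  The sandwich theorem, for g and the continuous convex
    function h - l, produces an eps-subgradient k of g such that l - k is one
    of h at 0. *)
Lemma eps_subdiff_sub_sum (R : realType) (X : tvsType R) (f g : X -> \bar R)
    (D : set X) (h : X -> R^o) (x : X) (eps : R)
    (f_gtNy : forall x, f x <> -oo%E) (g_gtNy : forall x, g x <> -oo%E)
    (domf : D = [set x | f x \is a fin_num])
    (domg : D = [set x | g x \is a fin_num])
    (D_convex : convex_set D) (g_convex : econvex_function g)
    (h_cont : continuous h) (h_convex : convex_function setT h) (h0 : h 0 = 0) :
  D x ->
  (forall y, D y -> fine (f y) - fine (f x)
                    <= fine (g y) - fine (g x) + h (y - x)) ->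
  eps_subdiff eps f x `<=`
  minkowski_sum (eps_subdiff eps g x) (eps_subdiff eps (EFin \o h) 0).
Proof.
move=> Dx fgh l /(eps_subdiffP f_gtNy domf _ _ Dx)[l_dual lf].
have [/linear_packed[L lE] l_cont] := l_dual.
pose H : X -> R^o := h \- l.
have [|||||d Dd _|k [k_dual kg kH]] :=
    @sandwich R X setT D H (fine \o g) x eps _ _ _ _ _ D_convex
      ((econvex_functionP g_gtNy domg D_convex).1 g_convex) Dx.
- by apply/convex_setP.
- apply/convex_functionP => t y z t0 t1 _ _.
  have := (convex_functionP _ _).1 h_convex t y z t0 t1 I I.
  by rewrite /H /= lE linearD !linearZ /= /GRing.scale /=; lra.
- exact: filterT.
- by apply: cvgB; [exact: h_cont|exact: l_cont].
- by rewrite /H /= h0 lE linear0 subr0.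
- by have := lf _ Dd; have := fgh _ Dd; rewrite /H /=; lra.
exists k; first exact/(eps_subdiffP g_gtNy domg).
exists (l \- k); last by apply/funext => y /=; rewrite subrKC.
split=> [|y]; first exact: topological_dualB.
rewrite subr0 -EFinB lee_fin h0 subr0 /=.
by have := kH y I; rewrite /H /=; lra.
Qed.

Unset Implicit Arguments.

Theorem theorem1 (R : realType) (X : tvsType R) (hausX : hausdorff_space X)
    (f g : X -> \bar R) (D : set X) (h : X -> R^o)
    (f_gtNy : forall x, f x <> -oo%E) (g_gtNy : forall x, g x <> -oo%E)
    (domf : D = [set x | f x \is a fin_num])
    (domg : D = [set x | g x \is a fin_num])
    (D_neq0 : D !=set0) (D_convex : convex_set D)
    (h_cont : continuous h) (h_convex : convex_function setT h)
    (h0 : h 0 = 0) :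
  let dsum (eps : R) (x : X) :=
    minkowski_sum (eps_subdiff eps g x) (eps_subdiff eps (EFin \o h) 0) in
  [<->
   (* (i) *)
   [/\ econvex_function f, econvex_function g,
       lower_semicontinuous_on D f, lower_semicontinuous_on D g &
       forall x y, D x -> D y -> (f x - g x <= f y - g y + (h (x - y))%:E)%E];
   (* (ii) *)
   forall x, D x -> forall eps : R, 0 < eps ->
     eps_subdiff eps f x !=set0 /\ eps_subdiff eps f x `<=` dsum eps x;
   (* (iii) *)
   forall x, D x -> exists2 delta : R, 0 < delta &
     forall eps : R, 0 < eps < delta ->
       eps_subdiff eps f x !=set0 /\ eps_subdiff eps f x `<=` dsum eps x;
   (* (iv) *)
   forall x, D x -> forall eps : R, 0 < eps ->
     eps_subdiff eps f x `&` dsum eps x !=set0;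
   (* (v) *)
   forall x, D x -> exists2 delta : R, 0 < delta &
     forall eps : R, 0 < eps < delta ->
       eps_subdiff eps f x `&` dsum eps x !=set0
  ].
Proof.
move=> dsum.
have inter_le x (e e' : R) : e <= e' ->
    eps_subdiff e f x `&` dsum e x `<=` eps_subdiff e' f x `&` dsum e' x.
  move=> ee' l [lf [u ug [v vh uv]]]; split; first exact: eps_subdiff_le lf.
  exists u; first exact: eps_subdiff_le ug.
  by exists v; first exact: eps_subdiff_le vh.
have real_ineq x y : D x -> D y ->
    (f x - g x <= f y - g y + (h (x - y))%:E)%E =
    (fine (f x) - fine (g x) <= fine (f y) - fine (g y) + h (x - y)).
  move=> Dx Dy; rewrite (dom_fineK domf Dx) (dom_fineK domg Dx).
  by rewrite (dom_fineK domf Dy) (dom_fineK domg Dy).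
have all_eps x (delta eps : R) : 0 < delta -> 0 < eps ->
    (forall e, 0 < e < delta -> eps_subdiff e f x `&` dsum e x !=set0) ->
    eps_subdiff eps f x `&` dsum eps x !=set0.
  move=> delta0 eps0 Hx; pose e := Num.min eps (delta / 2).
  have [|l lx] := Hx e.
    rewrite lt_min eps0 divr_gt0//= gt_min orbC ltr_pdivrMr// ltr_pMr//.
    by rewrite ltr1n.
  by exists l; apply: inter_le lx; rewrite ge_min lexx.
tfae.
- move=> [cf cg lscf _ fgh] x Dx eps eps0; split.
    exact: (eps_subdiff_neq0 f_gtNy domf).
  apply: (eps_subdiff_sub_sum f_gtNy g_gtNy domf domg) => // y Dy.
  have := fgh y x Dy Dx; rewrite real_ineq//; lra.
- by move=> ii x Dx; exists 1 => // eps /andP[eps0 _]; exact: ii.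
- move=> iii x Dx eps eps0; have [delta delta0 Hx] := iii x Dx.
  apply: (all_eps x delta) => // e /Hx[[l lf] /(_ _ lf) ldsum].
  by exists l.
- by move=> iv x Dx; exists 1 => // eps /andP[eps0 _]; exact: iv.
move=> v.
have iv x : D x -> forall eps, 0 < eps ->
    eps_subdiff eps f x `&` dsum eps x !=set0.
  by move=> Dx eps eps0; have [delta d0 Hx] := v x Dx; exact: all_eps Hx.
have f_sub x : D x -> forall eps, 0 < eps -> eps_subdiff eps f x !=set0.
  by move=> Dx eps eps0; have [l [lf _]] := iv x Dx eps eps0; exists l.
have g_sub x : D x -> forall eps, 0 < eps -> eps_subdiff eps g x !=set0.
  by move=> Dx eps eps0; have [l [_ [u ug _]]] := iv x Dx eps eps0; exists u.
split.
- exact: (eps_subdiff_neq0_convex f_gtNy domf).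
- exact: (eps_subdiff_neq0_convex g_gtNy domg).
- exact: (eps_subdiff_neq0_lsc f_gtNy domf).
- exact: (eps_subdiff_neq0_lsc g_gtNy domg).
move=> x y Dx Dy; rewrite real_ineq//.
apply: (@increment_comparison R X D (fine \o f) (fine \o g) h) => // z Dz e e0.
have [l [lf [u ug [w wh uwE]]]] := iv z Dz e e0.
move: lf => /(eps_subdiffP f_gtNy domf _ _ Dz)[_]; rewrite -uwE => uwf.
move: ug => /(eps_subdiffP g_gtNy domg _ _ Dz)[[/linear_packed[U UE] _] ug].
move: wh => [[/linear_packed[W WE] _] wh].
exists U, W; split=> //; first by rewrite -UE -WE.
  by rewrite -UE.
by move=> d; have := wh d; rewrite subr0 -EFinB lee_fin h0 subr0 WE.
Qed.
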